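(* Let $f:\mathbb{R}^n\times\mathbb{R}^m\to\mathbb{R}^n$ be continuous and locally Lipschitz continuous in $x$ uniformly in $u$, and assume that the finite-dimensional system $\dot x=f(x,u)$, with inputs $u\in\mathcal{U}=L_\infty(\mathbb{R}_+,\mathbb{R}^m)$, is forward complete. Then the system is sISS if and only if it is ISS.
   Context: $X=\mathbb{R}^n$ with norm $|\cdot|$; $\mathcal{U}=L_\infty(\mathbb{R}_+,\mathbb{R}^m)$ carries the essential supremum norm $\|\cdot\|_{\mathcal{U}}$; $\phi(t,x,u)$ is the (Carathéodory) solution at time $t$ with initial condition $x$ and input $u$. Forward completeness: $\phi(t,x,u)$ is defined for all $t\ge0$, $x\in X$, $u\in\mathcal{U}$. $\mathcal{K}$: continuous strictly increasing $\gamma:\mathbb{R}_+\to\mathbb{R}_+$ with $\gamma(0)=0$; $\mathcal{K}_\infty$: unbounded elements of $\mathcal{K}$; $\mathcal{L}$: continuous strictly decreasing $\gamma:\mathbb{R}_+\to\mathbb{R}_+$ with limit $0$ at $\infty$; $\mathcal{KL}$: continuous $\beta:\mathbb{R}_+^2\to\mathbb{R}_+$ with $\beta(\cdot,t)\in\mathcal{K}$ for all $t\ge0$ and $\beta(r,\cdot)\in\mathcal{L}$ for all $r>0$. - ISS: there are $\beta\in\mathcal{KL}$, $\gamma\in\mathcal{K}$ with $|\phi(t,x,u)|\le\beta(|x|,t)+\gamma(\|u\|_{\mathcal{U}})$ for all $x\in X$, $u\in\mathcal{U}$, $t\ge0$. - sISS (strong input-to-state stability): there are $\gamma\in\mathcal{K}$,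 $\sigma\in\mathcal{K}_\infty$, $\beta:X\times\mathbb{R}_+\to\mathbb{R}_+$ such that $\beta(x,\cdot)\in\mathcal{L}$ for all $x\ne0$; $\beta(x,t)\le\sigma(|x|)$ for all $x\in X$, $t\ge0$; and $|\phi(t,x,u)|\le\beta(x,t)+\gamma(\|u\|_{\mathcal{U}})$ for all $x\in X$, $u\in\mathcal{U}$, $t\ge0$. *)

(* Defs.v *)
From mathcomp Require Import all_boot all_order all_algebra.
From mathcomp Require Import all_classical all_reals all_analysis.
From mathcomp Require Import ess_sup_inf.

Set Implicit Arguments.
Unset Strict Implicit.
Unset Printing Implicit Defensive.

Import Order.TTheory GRing.Theory Num.Theory.
Import numFieldNormedType.Exports.

Local Open Scope classical_set_scope.
Local Open Scope ring_scope.

(* R^n and R^m are types of row vectors with their standard topology. Their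
   norms are explicit parameters nX and nU: the library norm on row vectors is
   the sup norm, and no particular norm is intended here. Functions defined on
   the half-line R_+ are total functions on R used only on `[0, +oo[. *)

Record is_norm (R : realType) (V : lmodType R) (N : V -> R) : Prop := IsNorm {
  is_norm_triangle : forall x y, N (x + y) <= N x + N y ;
  is_norm_scale : forall (a : R) x, N (a *: x) = `|a| * N x ;
  is_norm_definite : forall x, N x = 0 -> x = 0 }.

Section ComparisonFunctions.
Context {R : realType}.

(* Nonnegativity on `[0, +oo[ follows from the clauses of class_K and class_L. *)
Definition class_K (g : R -> R) : Prop :=
  [/\ {within `[0, +oo[, continuous g},
      (forall r s : R, 0 <= r -> r < s -> g r < g s) &
      g 0 = 0].

Definition class_Koo (g : R -> R) : Prop :=
  class_K g /\ forall M : R, exists2 r : R, 0 <= r & M < g r.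

Definition class_L (g : R -> R) : Prop :=
  [/\ {within `[0, +oo[, continuous g},
      (forall s t : R, 0 <= s -> s < t -> g t < g s) &
      g t @[t --> +oo] --> 0].

Definition class_KL (b : R -> R -> R) : Prop :=
  [/\ {within [set p : R * R | 0 <= p.1 /\ 0 <= p.2],
         continuous (fun p : R * R => b p.1 p.2)},
      (forall t : R, 0 <= t -> class_K (b^~ t)) &
      (forall r : R, 0 < r -> class_L (b r))].

End ComparisonFunctions.

Section System.
Context {R : realType} {n m : nat}.
Notation X := 'rV[R]_n.
Notation V := 'rV[R]_m.
Implicit Types (nX : X -> R) (nU : V -> R) (f : X -> V -> X) (u : R -> V)
  (phi : R -> X -> (R -> V) -> X).

Notation mu := (@lebesgue_measure R).

(* The restriction vanishes outside `[0, +oo[, so by nonnegativity of nU this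
   is the essential supremum of nU (u t) over t >= 0. *)
Definition ess_sup_norm nU u : \bar R :=
  ess_sup mu (EFin \o ((nU \o u) \_ `[0, +oo[)).

(* Elements of L_oo(R_+, R^m) are represented by functions. Measurability is
   with respect to the Borel sigma-algebra; every Lebesgue class has a Borel
   representative. *)
Definition input nU u : Prop :=
  (forall j : 'I_m, measurable_fun (`[0, +oo[ : set R) (fun t => u t 0 j)) /\
  (ess_sup_norm nU u < +oo)%E.

Definition input_norm nU u : R := fine (ess_sup_norm nU u).

Definition locally_lipschitz_unif nX f : Prop :=
  forall x0 : X, exists L : R, exists2 A : set X, nbhs x0 A &
    forall x y v, A x -> A y -> nX (f x v - f y v) <= L * nX (x - y).

(* Caratheodory solution on `[0, +oo[ of x' = f(x, u), xi(0) = x, in integral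
   form; this is the same as being locally absolutely continuous and satisfying
   the equation almost everywhere. *)
Definition caratheodory_solution f (x : X) u (xi : R -> X) : Prop :=
  {within `[0, +oo[, continuous xi} /\
  forall t : R, 0 <= t -> forall i : 'I_n,
    mu.-integrable `[0, t] (fun s => (f (xi s) (u s) 0 i)%:E) /\
    xi t 0 i = x 0 i + \int[mu]_(s in `[0, t]) f (xi s) (u s) 0 i.

(* phi t x u is the solution at time t, for every initial condition and every
   input, on the whole half-line. Such a phi exists exactly when the system is
   forward complete; for f locally Lipschitz as above, it is unique. *)
Definition forward_complete nU f phi : Prop :=
  forall x u, input nU u -> caratheodory_solution f x u (fun t => phi t x u).

Definition ISS nX nU phi : Prop :=
  exists (b : R -> R -> R) (g : R -> R),
    [/\ class_KL b, class_K g &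
        forall (x : X) u (t : R), input nU u -> 0 <= t ->
          nX (phi t x u) <= b (nX x) t + g (input_norm nU u)].

Definition sISS nX nU phi : Prop :=
  exists (g sigma : R -> R) (b : X -> R -> R),
    [/\ class_K g, class_Koo sigma,
        (forall (x : X) (t : R), 0 <= t -> 0 <= b x t),
        (forall x : X, x != 0 -> class_L (b x)) &
        (forall (x : X) (t : R), 0 <= t -> b x t <= sigma (nX x)) /\
        (forall (x : X) u (t : R), input nU u -> 0 <= t ->
          nX (phi t x u) <= b x t + g (input_norm nU u))].

End System.

(* Main.v *)
Require Import Defs.
From mathcomp Require Import all_boot all_order all_algebra.
From mathcomp Require Import all_classical all_reals all_analysis.
From mathcomp Require Import ess_sup_inf measurable_realfun ring lra.
Import Order.TTheory GRing.Theory Num.Theory.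
Import numFieldNormedType.Exports.
Local Open Scope classical_set_scope.
Local Open Scope ring_scope.
Set Implicit Arguments.
Unset Strict Implicit.
Unset Printing Implicit Defensive.

(** ISS implies sISS because beta(|x|, t), with sigma(r) = beta(r, 0) + r, is
    already a strong estimate.

    Conversely, an sISS estimate decays at a rate that may depend on the whole
    initial state x, so the point is to make the settling time uniform over
    balls.  Fix a ball of radius r and inputs of norm at most r.  By the sISS
    estimate all the trajectories involved stay in one larger ball, on which f
    has a Lipschitz constant that does not depend on the input value
    (lipschitz_on_ball); a Gronwall estimate (caratheodory_solution_dist_ball)
    then makes x |-> phi(T, x, u) continuous on the ball, uniformly in u.
    Hence, if beta(x0, T0) is small, all trajectories starting close to x0 are
    at time T0 of size at most a small number plus gamma(|u|), whatever u is.
    Restarting at time T0 from there (restart_bound) and using the uniform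
    bound sigma(|x|) + gamma(|u|) shows that they remain small, up to a gain,
    for all later times.  Compactness of the ball turns these local settling
    times into a single one (uniform_attractivity).  When |u| exceeds the
    radius of the ball containing x, the uniform bound is at most
    sigma(|u|) + gamma(|u|) and this is absorbed in the gain.

    It remains to dominate a family of numbers y, indexed by radii a and times
    s, such that y <= sigma(a) and y -> 0 as s -> oo uniformly for bounded a,
    by a single function of class KL (class_KL_majorant).  Dividing y by
    C(a) = (1 + a)(1 + sigma(a)) makes the decay uniform in a, so that
    y <= C(a) l(s) with l of class L; the geometric mean of this bound and of
    y <= sigma(a) is the product of a function of class K of a and of a
    function of class L of s.

    Restarting requires that a time shift of an input be an input, and that a
    time shift of a solution be a solution: both come from the translation
    invariance of the Lebesgue measure. *)

(** * Elementary properties of norms *)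

Section Norm.
Context {R : realType} {V : lmodType R} (N : V -> R) (normN : is_norm N).

Lemma is_norm0 : N 0 = 0.
Proof. by have := is_norm_scale normN 0 0; rewrite scale0r normr0 mul0r. Qed.

Lemma is_normN x : N (- x) = N x.
Proof. by rewrite -scaleN1r (is_norm_scale normN) normrN1 mul1r. Qed.

Lemma is_norm_ge0 x : 0 <= N x.
Proof.
have := is_norm_triangle normN x (- x).
by rewrite subrr is_norm0 is_normN; lra.
Qed.

Lemma is_norm_gt0 x : x != 0 -> 0 < N x.
Proof.
move=> x0; rewrite lt_neqAle is_norm_ge0 andbT eq_sym.
by apply: contra_neq x0; exact: is_norm_definite.
Qed.

End Norm.

(** * Translation of the Lebesgue measure and of inputs *)

Section Translation.
Context {R : realType}.
Notation mu := (@lebesgue_measure R).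
Notation T := (measurableTypeR R).

Lemma measurable_translation (c : R) :
  measurable_fun setT (fun s : T => c + s : T).
Proof. exact: measurable_funD. Qed.

(** The canonical measure structure of a pushforward depends on a proof of
    measurability that is not inferred, hence the explicit instance. *)
Let translated c : {measure set T -> \bar R} :=
  measure_function_pushforward__canonical__measure_function_Measure
    mu (measurable_translation c).

(** Both sides are measures in A which agree on the half-open intervals, and
    such a measure is unique. *)
Lemma lebesgue_measure_translation (c : R) (A : set T) :
  measurable A -> mu ((fun s => c + s) @^-1` A) = mu A.
Proof.
move=> mA; apply/esym.
suff -> : mu A = translated c A by [].
apply: lebesgue_measure_unique => // _ [[a b] _ <-] /=; rewrite /pushforward.
have -> : (fun s : T => c + s) @^-1` `]a, b] = `](a - c), (b - c)]%classic.
  by apply/seteqP; split => s /=; rewrite !in_itv/= ltrBlDl lerBrDl.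
rewrite !lebesgue_measure_itv/= !lte_fin ltrD2r -!EFinB; case: ifP => // _.
by congr EFin; lra.
Qed.

Lemma ae_translation (c : R) (P : T -> Prop) :
  (\forall s \ae mu, P s) -> \forall s \ae mu, P (c + s).
Proof.
move=> [N [mN N0 PN]]; exists ((fun s => c + s) @^-1` N); split.
- rewrite -[_ @^-1` _]setTI; exact: measurable_translation.
- by rewrite -[RHS]N0; exact: lebesgue_measure_translation.
- by move=> s /= Ps; apply: PN.
Qed.

Lemma ge0_integral_translation (c : R) (h : T -> \bar R) :
  measurable_fun setT h -> (forall s, 0 <= h s)%E ->
  (\int[mu]_s h (c + s)%R = \int[mu]_s h s)%E.
Proof.
move=> mh h0.
have -> : (\int[mu]_s h s = \int[translated c]_s h s)%E.
  apply: eq_measure_integral => A mA _; apply/esym.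
  exact: lebesgue_measure_translation.
rewrite (ge0_integral_pushforward (measurable_translation c))//.
Qed.

Lemma integrable_translation (c : R) (h : T -> \bar R) :
  mu.-integrable setT h -> mu.-integrable setT (fun s => h (c + s)).
Proof.
move=> /integrableP[mh hoo]; apply/integrableP; split.
  exact: measurableT_comp mh (measurable_translation c).
rewrite (@ge0_integral_translation c (fun s => `|h s|)%E)//.
exact: measurableT_comp.
Qed.

Lemma integral_translation (c : R) (h : T -> \bar R) :
  mu.-integrable setT h -> (\int[mu]_s h (c + s)%R = \int[mu]_s h s)%E.
Proof.
move=> ih; have /integrableP[mh _] := ih.
have -> : (\int[mu]_s h s = \int[translated c]_s h s)%E.
  apply: eq_measure_integral => A mA _; apply/esym.
  exact: lebesgue_measure_translation.
rewrite (integral_pushforward (measurable_translation c))//.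
exact: integrable_translation.
Qed.

Lemma restrict_translation (c t : R) (g : R -> R) :
  (fun s : R => ((EFin \o g) \_ `[c, c + t]) (c + s)) =
  (fun s => (g (c + s))%:E) \_ `[0, t].
Proof.
apply/funext => s; rewrite /patch /=.
by congr (if _ then _ else _); apply/idP/idP;
  rewrite !inE/= !in_itv/= lerDl lerD2l.
Qed.

(** With Rintegral_tail, this turns the integral equation of a trajectory into
    that of the trajectory restarted at time c. *)
Lemma integrable_tail (c t : R) (g : R -> R) : 0 <= c -> 0 <= t ->
  mu.-integrable `[0, c + t] (EFin \o g) ->
  mu.-integrable `[0, t] (fun s => (g (c + s))%:E).
Proof.
move=> c0 t0 ig; apply/integrable_mkcond => //.
rewrite -restrict_translation; apply: integrable_translation.
have mc : measurable (`[c, c + t]%classic : set T) by [].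
apply: (integrable_mkcond (mu := mu) (EFin \o g) mc).1.
apply: integrableS ig => //.
by move=> s /=; rewrite !in_itv/= => /andP[cs ->]; rewrite (le_trans c0).
Qed.

Lemma Rintegral_tail (c t : R) (g : R -> R) : 0 <= c -> 0 <= t ->
  mu.-integrable `[0, c + t] (EFin \o g) ->
  \int[mu]_(s in `[0, c + t]) g s =
  \int[mu]_(s in `[0, c]) g s + \int[mu]_(s in `[0, t]) g (c + s).
Proof.
move=> c0 t0 ig.
have mc : measurable (`[c, c + t]%classic : set T) by [].
have igc : mu.-integrable `[c, c + t] (EFin \o g).
  apply: integrableS ig => //.
  by move=> s /=; rewrite !in_itv/= => /andP[cs ->]; rewrite (le_trans c0).
have := Rintegral_itvB ig; move=> /(_ c); rewrite !bnd_simp c0 lerDl t0.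
move=> /(_ isT isT) /(canRL (subrK _)) ->; rewrite addrC; congr (_ + _).
rewrite Rintegral_itv_obnd_cbnd; last first.
  by apply: integrableS igc => //; apply: subset_itvr; rewrite bnd_simp.
rewrite /Rintegral; congr fine.
rewrite integral_mkcond [RHS]integral_mkcond -restrict_translation.
by rewrite (integral_translation _ ((integrable_mkcond (mu := mu) _ mc).1 igc)).
Qed.

End Translation.

Section Inputs.
Context {R : realType} {m : nat} (nU : 'rV[R]_m -> R) (nU_norm : is_norm nU).
Notation mu := (@lebesgue_measure R).

Lemma ess_sup_norm_ge0 u : (0 <= ess_sup_norm nU u)%E.
Proof.
apply: ess_sup_gee.
  have := lebesgue_measure_itv (`]-oo, +oo[ : interval R).
  rewrite set_itvNyy/= => ->; by rewrite addye // ltry.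
apply: aeW => t; rewrite /=; rewrite lee_fin patchE; case: ifP => // _.
exact: (is_norm_ge0 nU_norm).
Qed.

Lemma input_norm_ge0 u : 0 <= input_norm nU u.
Proof. exact: fine_ge0 (ess_sup_norm_ge0 u). Qed.

(** Translations preserve null sets, and a translation by c >= 0 maps the
    half-line into itself. *)
Lemma ess_sup_norm_tail (c : R) u : 0 <= c ->
  (ess_sup_norm nU (fun t => u (c + t)%R) <= ess_sup_norm nU u)%E.
Proof.
move=> c0; apply/ess_supP.
have := ae_translation c (ess_sup_ge mu (EFin \o ((nU \o u) \_ `[0, +oo[))).
apply: (@filterS _ _ (ae_filter_ringOfSetsType mu)) => t; apply: le_trans.
rewrite /= lee_fin !patchE /=.
case: ifPn => [|_]; last by case: ifP => // _; exact: (is_norm_ge0 nU_norm).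
rewrite inE/= in_itv/= andbT => t0.
by rewrite ifT// inE/= in_itv/= andbT addr_ge0.
Qed.

Lemma input_tail (c : R) u : 0 <= c -> input nU u -> input nU (fun t => u (c + t)).
Proof.
move=> c0 [mu_ uoo]; split; last exact: le_lt_trans (ess_sup_norm_tail u c0) uoo.
move=> j.
apply: (@measurable_comp _ _ _ R R R
  (`[0, +oo[%classic : set R) (fun t => u t 0 j) `[0, +oo[%classic
  (fun t => c + t)) => //.
  by move=> _ [t + <-]; rewrite /= !in_itv/= !andbT => t0; rewrite addr_ge0.
exact: measurable_funD.
Qed.

Lemma input_norm_tail (c : R) u : 0 <= c -> input nU u ->
  input_norm nU (fun t => u (c + t)) <= input_norm nU u.
Proof.
move=> c0 iu; apply: fine_le; last exact: ess_sup_norm_tail.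
  by rewrite ge0_fin_numE ?ess_sup_norm_ge0//; case: (input_tail c0 iu).
by rewrite ge0_fin_numE ?ess_sup_norm_ge0//; case: iu.
Qed.

End Inputs.

(** * Norms on row vectors and Lipschitz constants on balls *)

Section NormEquivalence.
Context {R : realType} {n : nat} (N : 'rV[R]_n -> R) (normN : is_norm N).

(** The norm of the normed module of row vectors is the sup norm: coordinatewise
    integral estimates are estimates in that norm, and the next lemmas compare
    it with an arbitrary norm N. *)
Lemma coord_le_norm (x : 'rV[R]_n) i : `|x 0 i| <= `|x|.
Proof.
rewrite [leRHS]/Num.Def.normr/= mx_normrE.
by apply: (le_bigmax _ (fun ij : 'I_1 * 'I_n => `|x ij.1 ij.2|) (0, i)).
Qed.

Lemma norm_le_coord (x : 'rV[R]_n) c : 0 <= c ->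
  (forall i, `|x 0 i| <= c) -> `|x| <= c.
Proof.
move=> c0 xc; rewrite /Num.Def.normr/= mx_normrE.
by apply: bigmax_le => // -[i j] _ /=; rewrite ord1.
Qed.

Lemma is_norm_le_sup : exists2 C, 0 < C & forall x, N x <= C * `|x|.
Proof.
exists (1 + \sum_(i < n) N (delta_mx 0 i)).
  by rewrite ltr_pwDl// sumr_ge0// => i _; exact: is_norm_ge0.
move=> x; rewrite [X in N X]row_sum_delta.
apply: (@le_trans _ _ (\sum_(i < n) N (delta_mx 0 i) * `|x|)); last first.
  by rewrite mulrDl mulr_suml lerDr mul1r.
elim/big_ind2 : _ => [|u a v b ua vb|i _].
- by rewrite (is_norm0 normN).
- by rewrite (le_trans (is_norm_triangle normN _ _))// lerD.
- rewrite (is_norm_scale normN) mulrC ler_wpM2l ?coord_le_norm//.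
  exact: is_norm_ge0.
Qed.

Lemma is_norm_lipschitz x y : N x - N y <= N (x - y).
Proof. by have := is_norm_triangle normN (x - y) y; rewrite subrK; lra. Qed.

Lemma is_norm_continuous : continuous N.
Proof.
have [C C0 NC] := is_norm_le_sup => x.
apply/(cvgrPdist_lt (F := nbhs x)) => e e0.
apply: (@filterS _ (nbhs x) (nbhs_filter x) (ball x (C^-1 * e))); last first.
  by apply: nbhsx_ballx; rewrite mulr_gt0// invr_gt0.
move=> y; rewrite -ball_normE/= ltr_pdivlMl// => xy.
rewrite (le_lt_trans _ xy)// (le_trans _ (NC _))// ler_norml.
have := is_norm_lipschitz x y; have := is_norm_lipschitz y x.
by rewrite -(is_normN normN (y - x)) opprB; lra.
Qed.

(** N attains a positive minimum on the unit sphere of the sup norm; the sphere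
    is empty exactly in dimension zero. *)
Lemma is_norm_ge_sup : exists2 c, 0 < c & forall x, `|x| <= c * N x.
Proof.
pose S := [set x : 'rV[R]_n | `|x| = 1].
have unitS x : x != 0 -> S (`|x|^-1 *: x).
  by move=> x0; rewrite /S /= normrZ normfV normr_id mulVf// normr_eq0.
have [S0|S0] := pselect (S !=set0); last first.
  exists 1 => // x; have [->|/unitS Sx] := eqVneq x 0.
    by rewrite normr0 (is_norm0 normN) mulr0.
  by exfalso; apply: S0; eexists; exact: Sx.
have cS : compact S.
  apply: bounded_closed_compact.
    by exists 1; split => // M M1 x; rewrite /S /= => ->; exact: ltW.
  have -> : S = (fun x : 'rV[R]_n => `|x|) @^-1` [set 1] by [].
  apply: closed_comp; last exact: closed_eq.
  by move=> x _; exact: norm_continuous.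
have [z + zmin] := compact_EVT_min S0 cS
  (continuous_subspaceT is_norm_continuous).
rewrite inE => Sz.
have Nz : 0 < N z.
  apply: (is_norm_gt0 normN); apply/eqP => z0.
  by move: Sz; rewrite /S /= z0 normr0 => /esym/eqP; rewrite oner_eq0.
exists (N z)^-1; first by rewrite invr_gt0.
move=> x; have [->|x0] := eqVneq x 0.
  by rewrite normr0 (is_norm0 normN) mulr0.
have xp : 0 < `|x| by rewrite normr_gt0.
have := zmin (`|x|^-1 *: x); rewrite inE => /(_ (unitS _ x0)).
rewrite (is_norm_scale normN) normfV normr_id.
by rewrite ler_pdivlMl// mulrC -ler_pdivlMl.
Qed.

Lemma compact_is_norm_ball r : compact [set x | N x <= r].
Proof.
have [c c0 Nc] := is_norm_ge_sup.
apply: bounded_closed_compact.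
  exists (c * r); split => [|M rM x /= xr]; first exact: num_real.
  by rewrite (le_trans (Nc _))// (le_trans _ (ltW rM))// ler_wpM2l// ltW.
have -> : [set x | N x <= r] = N @^-1` [set y | y <= r] by [].
apply: closed_comp; last exact: closed_le.
by move=> x _; exact: is_norm_continuous.
Qed.

End NormEquivalence.

Section LipschitzOnBalls.
Context {R : realType} {n m : nat} (nX : 'rV[R]_n -> R)
  (f : 'rV[R]_n -> 'rV[R]_m -> 'rV[R]_n).
Hypotheses (nX_norm : is_norm nX) (f_lip : locally_lipschitz_unif nX f).

(** Local Lipschitz constants on a compact ball, made uniform: compactness gives
    one d that serves both as the scale on which f is Lipschitz and, through
    its inverse, as the Lipschitz constant. *)
Lemma lipschitz_unif_scale r : exists2 d : R, 0 < d &
  forall x y v, nX x <= r -> `|x - y| < d ->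
    nX (f x v - f y v) <= d^-1 * nX (x - y).
Proof.
pose P (d : R) x := forall y v, `|x - y| < d ->
  nX (f x v - f y v) <= d^-1 * nX (x - y).
suff [d [d0 Pd]] : exists d : R, 0 < d /\ [set x | nX x <= r] `<=` P d.
  by exists d => // x y v xr; exact: Pd.
have near_P : \forall d \near (0 : R)^'+, [set x | nX x <= r] `<=` P d.
  have /compact_near_coveringP cov := compact_is_norm_ball (r := r) nX_norm.
  apply: cov.
  move=> x0 _; have [L [A nbA LA]] := f_lip x0.
  have /nbhs_ballP[e /= e0 eA] := nbA.
  have L0 : 0 < 1 + `|L| by have := normr_ge0 L; lra.
  exists (ball x0 (e / 2), [set d : R | 0 < d < Num.min (e / 2) (1 + `|L|)^-1]).
    split => /=; first by apply: nbhsx_ballx; rewrite divr_gt0.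
    near=> d; apply/andP; split; first by near: d; exact: nbhs_right_gt.
    by near: d; apply: nbhs_right_lt; rewrite lt_min divr_gt0//= invr_gt0.
  move=> [x d] [/= x0x /andP[d0]]; rewrite lt_min => /andP[de dL] y v xy.
  rewrite (le_trans (LA x y v _ _))//.
  - apply: eA; apply: le_ball x0x; rewrite ler_pdivrMr//; lra.
  - apply: eA; rewrite [e]splitr; apply: ball_triangle x0x _.
    by rewrite -ball_normE/=; lra.
  - rewrite ler_wpM2r ?(is_norm_ge0 nX_norm)//.
    rewrite (le_trans (ler_norm L))// ltW//.
    rewrite -ltf_pV2 ?posrE ?invr_gt0 ?invrK// in dL.
    by rewrite (lt_trans _ dL)// ltrDr.
near (0 : R)^'+ => d; exists d; split; near: d => //; exact: nbhs_right_gt.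
Unshelve. all: by end_near. Qed.

Lemma is_norm_ball_segment r x y (t : R) : 0 <= t <= 1 ->
  nX x <= r -> nX y <= r -> nX (x + t *: (y - x)) <= r.
Proof.
move=> /andP[t0 t1] xr yr.
have -> : x + t *: (y - x) = (1 - t) *: x + t *: y.
  by rewrite scalerBr scalerBl scale1r addrA addrAC.
rewrite (le_trans (is_norm_triangle nX_norm _ _))//.
rewrite !(is_norm_scale nX_norm) !ger0_norm ?subr_ge0//.
have : (1 - t) * nX x <= (1 - t) * r by rewrite ler_wpM2l// subr_ge0.
have : t * nX y <= t * r by rewrite ler_wpM2l.
lra.
Qed.

(** Two points of the ball are joined by a segment in the ball; cutting it into
    pieces shorter than the scale of lipschitz_unif_scale and summing the
    increments of f removes the restriction to close points. *)
Lemma lipschitz_on_ball r : exists2 L : R, 0 < L &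
  forall x y v, nX x <= r -> nX y <= r -> `|f x v - f y v| <= L * `|x - y|.
Proof.
have [d d0 fd] := lipschitz_unif_scale r.
have [C C0 NC] := is_norm_le_sup nX_norm.
have [c c0 Nc] := is_norm_ge_sup nX_norm.
exists (c * (d^-1 * C)); first by rewrite !mulr_gt0// invr_gt0.
move=> x y v xr yr.
suff fN : nX (f x v - f y v) <= d^-1 * nX (x - y).
  rewrite (le_trans (Nc _))// -!mulrA ler_wpM2l ?(ltW c0)// (le_trans fN)//.
  by rewrite ler_wpM2l ?NC// ltW// invr_gt0.
pose k := Num.truncn (`|x - y| / d).
have kd : `|x - y| / k.+1%:R < d.
  rewrite ltr_pdivrMr// mulrC -ltr_pdivrMr//.
  by rewrite truncnS_gt.
pose z (i : nat) := x + (i%:R / k.+1%:R) *: (y - x).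
have zr i : (i <= k.+1)%N -> nX (z i) <= r.
  move=> ik; apply: is_norm_ball_segment => //.
  by rewrite divr_ge0//= ler_pdivrMr// mul1r ler_nat.
have zS i : z i - z i.+1 = k.+1%:R^-1 *: (x - y).
  rewrite /z opprD addrACA subrr add0r -scalerBl -mulrBl -natr1 opprD addrA.
  by rewrite subrr add0r mulN1r scaleNr -scalerN opprB.
have step i : (i <= k.+1)%N ->
    nX (f x v - f (z i) v) <= i%:R * (d^-1 * (nX (x - y) / k.+1%:R)).
  elim: i => [|i IH] ik.
    by rewrite /z mul0r scale0r addr0 subrr (is_norm0 nX_norm) mul0r.
  rewrite -(subrKA (f (z i) v)) (le_trans (is_norm_triangle nX_norm _ _))//.
  rewrite -natr1 mulrDl mul1r lerD ?IH// 1?ltnW//.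
  rewrite (le_trans (fd _ _ _ (zr _ (ltnW ik)) _))// zS.
    by rewrite normrZ normfV normr_nat mulrC.
  by rewrite (is_norm_scale nX_norm) normfV normr_nat [_^-1 * nX _]mulrC.
have := step k.+1 (leqnn _); rewrite /z divff ?pnatr_eq0// scale1r.
rewrite [x + _]addrC subrK => /le_trans; apply.
by rewrite mulrCA [k.+1%:R * _]mulrC divfK ?pnatr_eq0.
Qed.

End LipschitzOnBalls.

(** * Continuous dependence, uniqueness and restart of solutions *)

Section ContinuousDependence.
Context {R : realType} {n m : nat}.
Notation mu := (@lebesgue_measure R).

Lemma continuous_expR_scale (a : R) : continuous (fun s : R => expR (a * s)).
Proof.
move=> s; apply: continuous_comp; last exact: continuous_expR.
exact: mulrl_continuous.
Qed.

Lemma integrable_expR_scale (a c : R) :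
  mu.-integrable `[0, c] (EFin \o (fun s => expR (a * s))).
Proof.
apply: continuous_compact_integrable; first exact: segment_compact.
exact/continuous_subspaceT/continuous_expR_scale.
Qed.

Lemma Rintegral_expR_scale_le (a c : R) : 0 < a -> 0 <= c ->
  \int[mu]_(s in `[0, c]) expR (a * s) <= a^-1 * expR (a * c).
Proof.
move=> a0; rewrite le_eqVlt => /predU1P[<-|c0].
  by rewrite set_itv1 Rintegral_set1 mulr_ge0 ?invr_ge0 ?expR_ge0// ltW.
pose F s := a^-1 * expR (a * s).
have dF (s : R) : is_derive s (1 : R) F (expR (a * s)).
  rewrite /F; apply: is_derive_eq.
  by rewrite [_%:A]mulr1 mulrC [LHS]mulrA mulVf ?mul1r ?gt_eqF.
have cF (s : R) : F x @[x --> s] --> F s.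
  apply: differentiable_continuous; apply/derivable1_diffP.
  by have [] := dF s.
rewrite /Rintegral (@continuous_FTC2 _ _ F)//.
- by rewrite /= /F lerBlDr lerDl mulr_ge0 ?invr_ge0 ?expR_ge0// ltW.
- exact/continuous_subspaceT/continuous_expR_scale.
- split; first by move=> s _; have [] := dF s.
  + exact/cvg_at_right_filter/cF.
  + exact/cvg_at_left_filter/cF.
- by move=> s _; rewrite derive1E; have [] := dF s.
Qed.

Lemma within_continuous_dist A (xi1 xi2 : R -> 'rV[R]_n) :
  {within A, continuous xi1} -> {within A, continuous xi2} ->
  {within A, continuous (fun t => `|xi1 t - xi2 t|)}.
Proof.
move=> c1 c2 t; apply: cvg_norm; apply: cvgB; [exact: c1|exact: c2].
Qed.

(** Gronwall by a weighted supremum: at a point c where the distance times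
    exp(-2Lt) is maximal, with value g, the integral equation bounds the
    distance by |x1 - x2| + g L times the integral of exp(2Ls) over [0, c],
    hence by |x1 - x2| + g exp(2Lc) / 2, and the last term is absorbed in the
    left-hand side g exp(2Lc). *)
Lemma caratheodory_solution_dist (f : 'rV[R]_n -> 'rV[R]_m -> 'rV[R]_n)
    (L T : R) x1 x2 u xi1 xi2 :
  0 < L -> caratheodory_solution f x1 u xi1 ->
  caratheodory_solution f x2 u xi2 ->
  (forall s, 0 <= s <= T ->
    `|f (xi1 s) (u s) - f (xi2 s) (u s)| <= L * `|xi1 s - xi2 s|) ->
  forall t, 0 <= t <= T ->
    `|xi1 t - xi2 t| <= 2 * `|x1 - x2| * expR (2 * L * t).
Proof.
move=> L0 [c1 s1] [c2 s2] fL t /andP[t0 tT].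
have T0 : 0 <= T := le_trans t0 tT.
have a0 : 0 < 2 * L by rewrite mulr_gt0.
pose d s := `|xi1 s - xi2 s|.
pose g s := d s * expR (- (2 * L) * s).
have dg s : d s = g s * expR (2 * L * s).
  by rewrite /g -mulrA -expRD mulNr addNr expR0 mulr1.
have cd : {within `[0, T], continuous d}.
  have sub : `[0, T] `<=` (`[0, +oo[ : set R).
    by move=> s /=; rewrite !in_itv/= => /andP[->].
  by apply: within_continuous_dist; apply: continuous_subspaceW sub _.
have cg : {within `[0, T], continuous g}.
  move=> s; apply: cvgM; first exact: cd.
  by apply: (continuous_subspaceT (continuous_expR_scale (a := - (2 * L)))).
have [c] := EVT_max T0 cg; rewrite in_itv/= => /andP[c0 cT] gmax.
have gc0 : 0 <= g c by apply: mulr_ge0; [exact: normr_ge0|exact: expR_ge0].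
suff gc : g c <= 2 * `|x1 - x2|.
  rewrite -/(d t) dg ler_wpM2r ?expR_ge0// (le_trans (gmax _ _))//.
  by rewrite in_itv/= t0.
suff : d c <= `|x1 - x2| + g c * (2^-1 * expR (2 * L * c)).
  have -> : g c = d c * (expR (2 * L * c))^-1 by rewrite /g mulNr expRN.
  move=> dc; rewrite ler_pdivrMr ?expR_gt0//.
  have e1 : 1 <= expR (2 * L * c).
    by rewrite -[leLHS]expR0 ler_expR mulr_ge0 ?(ltW a0).
  have : `|x1 - x2| <= `|x1 - x2| * expR (2 * L * c) by rewrite ler_peMr.
  move: dc; rewrite -mulrA [(expR _)^-1 * _]mulrCA mulVf ?gt_eqF ?expR_gt0//.
  lra.
have e0 : 0 <= g c * (2^-1 * expR (2 * L * c)).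
  by rewrite mulr_ge0// mulr_ge0 ?expR_ge0 ?invr_ge0.
apply: norm_le_coord => [|i]; first by rewrite addr_ge0.
have [i1 e1] := s1 c c0 i; have [i2 e2] := s2 c c0 i.
rewrite !mxE e1 e2 opprD addrACA -RintegralB//.
rewrite (le_trans (ler_normD _ _))// lerD//.
  by have := coord_le_norm (x1 - x2) i; rewrite !mxE.
have mc : measurable (`[0, c]%classic : set (measurableTypeR R)) by [].
have i12 := integrableB (mu := mu) mc i1 i2.
rewrite (le_trans (le_normr_Rintegral _ _))//.
have -> : g c * (2^-1 * expR (2 * L * c)) =
    g c * L * ((2 * L)^-1 * expR (2 * L * c)).
  by field; rewrite gt_eqF.
apply: (@le_trans _ _ (\int[mu]_(s in `[0, c]) (g c * L * expR (2 * L * s)))).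
  apply: le_Rintegral => //.
  - exact: integrable_norm.
  - exact: (integrableZl _ _ (integrable_expR_scale _ _)).
  move=> s /=; rewrite in_itv/= => /andP[s0 sc].
  have sT : 0 <= s <= T by rewrite s0 (le_trans sc).
  have := coord_le_norm (f (xi1 s) (u s) - f (xi2 s) (u s)) i.
  rewrite !mxE => /le_trans; apply; rewrite (le_trans (fL _ sT))//.
  rewrite -/(d s) dg [g c * L]mulrC -[leRHS]mulrA ler_wpM2l ?(ltW L0)//.
  by rewrite ler_wpM2r ?expR_ge0// gmax// in_itv.
rewrite RintegralZl//; last exact: integrable_expR_scale.
by rewrite ler_wpM2l ?Rintegral_expR_scale_le// mulr_ge0// ltW.
Qed.

End ContinuousDependence.

(** Composition of functions that are continuous only relative to subsets, as
    are trajectories and comparison functions on the half-line. *)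
Lemma within_continuous_comp_sub {U V W : topologicalType} (A : set U)
    (B : set V) (h : U -> V) (g : V -> W) :
  (forall x, A x -> B (h x)) -> {within A, continuous h} ->
  {within B, continuous g} -> {within A, continuous (g \o h)}.
Proof.
move=> AB /subspace_continuousP ch /subspace_continuousP cg.
apply/subspace_continuousP => x Ax P /(cg _ (AB _ Ax)) => nP.
have : nbhs x (fun y => A y -> B (h y) -> P (g (h y))) by exact: (ch x Ax _ nP).
apply: (@filterS _ _ (nbhs_filter x)) => y Py Ay.
by apply: Py => //; exact: AB.
Qed.

Section Cocycle.
Context {R : realType} {n m : nat}.
Notation mu := (@lebesgue_measure R).

Lemma caratheodory_solution_tail (f : 'rV[R]_n -> 'rV[R]_m -> 'rV[R]_n)
    x u xi (c : R) : 0 <= c -> caratheodory_solution f x u xi ->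
  caratheodory_solution f (xi c) (fun t => u (c + t)) (fun t => xi (c + t)).
Proof.
move=> c0 [cxi sol]; split=> [|t t0 i].
  have := @within_continuous_comp_sub _ _ _ (`[0, +oo[ : set R) (`[0, +oo[ : set R)
    (fun t => c + t) xi.
  apply.
  - by move=> t; rewrite /= !in_itv/= !andbT; exact: addr_ge0.
  - apply: continuous_subspaceT => t.
    by apply: cvgD; [exact: cvg_cst|exact: cvg_id].
  - exact: cxi.
have ct0 := addr_ge0 c0 t0.
have [it ->] := sol _ ct0 i; have [_ ->] := sol _ c0 i.
split; first exact: (integrable_tail (g := fun s => f (xi s) (u s) 0 i)).
by rewrite (Rintegral_tail (g := fun s => f (xi s) (u s) 0 i))// addrA.
Qed.

Variables (nX : 'rV[R]_n -> R) (f : 'rV[R]_n -> 'rV[R]_m -> 'rV[R]_n).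
Hypotheses (nX_norm : is_norm nX) (f_lip : locally_lipschitz_unif nX f).

(** Continuous dependence on the initial state.  The constant does not depend on
    the input, because neither does the Lipschitz constant of f on a ball. *)
Lemma caratheodory_solution_dist_ball r T : exists2 C : R, 0 < C &
  forall x1 x2 u xi1 xi2, caratheodory_solution f x1 u xi1 ->
    caratheodory_solution f x2 u xi2 ->
    (forall s, 0 <= s <= T -> nX (xi1 s) <= r) ->
    (forall s, 0 <= s <= T -> nX (xi2 s) <= r) ->
    forall t, 0 <= t <= T -> nX (xi1 t - xi2 t) <= C * nX (x1 - x2).
Proof.
have [L L0 fL] := lipschitz_on_ball nX_norm f_lip r.
have [A A0 NA] := is_norm_le_sup nX_norm.
have [B B0 NB] := is_norm_ge_sup nX_norm.
exists (A * (2 * expR (2 * L * T) * B)).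
  by rewrite !mulr_gt0// expR_gt0.
move=> x1 x2 u xi1 xi2 s1 s2 r1 r2 t tT.
rewrite (le_trans (NA _))// -[leRHS]mulrA ler_wpM2l ?(ltW A0)//.
have dist := caratheodory_solution_dist L0 s1 s2.
rewrite (le_trans (dist T _ t tT))//.
  by move=> s sT; rewrite fL ?r1 ?r2.
rewrite -[leLHS]mulrA -[leRHS]mulrA -[leRHS]mulrA ler_wpM2l// mulrC.
apply: ler_pM.
- exact: expR_ge0.
- exact: normr_ge0.
- rewrite ler_expR ler_wpM2l ?mulr_ge0 ?(ltW L0)//.
  by case/andP: tT.
- exact: NB.
Qed.

(** On a compact time interval both solutions stay in some ball by continuity,
    so continuous dependence applies with equal initial states. *)
Lemma caratheodory_solution_unique x u xi1 xi2 :
  caratheodory_solution f x u xi1 -> caratheodory_solution f x u xi2 ->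
  forall t, 0 <= t -> xi1 t = xi2 t.
Proof.
move=> s1 s2 T T0.
have bound xi : caratheodory_solution f x u xi ->
    exists r : R, forall s, 0 <= s <= T -> nX (xi s) <= r.
  move=> [cxi _].
  have [A A0 NA] := is_norm_le_sup nX_norm.
  have cN : {within `[0, T], continuous (fun s => `|xi s|)}.
    have sub : `[0, T] `<=` (`[0, +oo[ : set R).
      by move=> s /=; rewrite !in_itv/= => /andP[->].
    by move=> s; apply: cvg_norm; exact: (continuous_subspaceW sub cxi).
  have [c _ cmax] := EVT_max T0 cN.
  exists (A * `|xi c|) => s sT; rewrite (le_trans (NA _))//.
  by rewrite ler_wpM2l ?(ltW A0)// cmax// in_itv.
have [r1 b1] := bound _ s1; have [r2 b2] := bound _ s2.
have [C C0 dist] := caratheodory_solution_dist_ball (Num.max r1 r2) T.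
apply/eqP; rewrite -subr_eq0; apply/eqP/(is_norm_definite nX_norm)/eqP.
rewrite eq_le (is_norm_ge0 nX_norm) andbT.
have := dist _ _ _ _ _ s1 s2; rewrite subrr (is_norm0 nX_norm) mulr0; apply.
- by move=> s sT; rewrite le_max b1.
- by move=> s sT; rewrite le_max b2 ?orbT.
- by rewrite T0 lexx.
Qed.

Variables (nU : 'rV[R]_m -> R) (phi : R -> 'rV[R]_n -> (R -> 'rV[R]_m) -> 'rV[R]_n).
Hypotheses (nU_norm : is_norm nU) (f_complete : forward_complete nU f phi).

Lemma flow_cocycle x u c t : input nU u -> 0 <= c -> 0 <= t ->
  phi (c + t) x u = phi t (phi c x u) (fun s => u (c + s)).
Proof.
move=> iu c0 t0.
exact: (caratheodory_solution_unique
  (caratheodory_solution_tail c0 (f_complete x iu))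
  (f_complete _ (input_tail nU_norm c0 iu)) t0).
Qed.

End Cocycle.

(** * Comparison functions *)

Section ComparisonFunctionLemmas.
Context {R : realType}.
Implicit Types g h l : R -> R.

Lemma class_K_ge0 g r : class_K g -> 0 <= r -> 0 <= g r.
Proof.
move=> [_ inc g0]; rewrite le_eqVlt => /predU1P[<-|r0]; first by rewrite g0.
by rewrite -g0 ltW// inc.
Qed.

Lemma class_K_gt0 g r : class_K g -> 0 < r -> 0 < g r.
Proof. by move=> [_ inc g0] r0; rewrite -g0 inc. Qed.

Lemma class_K_le g r s : class_K g -> 0 <= r -> r <= s -> g r <= g s.
Proof.
move=> [_ inc _] r0; rewrite le_eqVlt => /predU1P[->//|rs].
by rewrite ltW// inc.
Qed.

Lemma class_KD g h : class_K g -> class_K h -> class_K (fun r => g r + h r).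
Proof.
move=> [cg ig g0] [ch ih h0]; split; last by rewrite g0 h0 addr0.
- by move=> r; apply: cvgD; [exact: cg|exact: ch].
- by move=> r s r0 rs; rewrite ltrD ?ig ?ih.
Qed.

Lemma class_KZ (k : R) g : 0 < k -> class_K g -> class_K (fun r => k * g r).
Proof.
move=> k0 [cg ig g0]; split; last by rewrite g0 mulr0.
- by move=> r; apply: cvgM; [exact: cvg_cst|exact: cg].
- by move=> r s r0 rs; rewrite ltr_pM2l// ig.
Qed.

Lemma class_K_comp g h : class_K g -> class_K h -> class_K (fun r => g (h r)).
Proof.
move=> Kg Kh; have [cg ig g0] := Kg; have [ch ih h0] := Kh.
split; last by rewrite h0 g0.
- have := @within_continuous_comp_sub _ _ _ (`[0, +oo[ : set R)
    (`[0, +oo[ : set R) h g; apply => //.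
  by move=> r; rewrite /= !in_itv/= !andbT; exact: class_K_ge0.
- by move=> r s r0 rs; rewrite ig ?ih// class_K_ge0.
Qed.

(** The larger of r and s is at least half of their sum. *)
Lemma class_KD_le g r s : class_K g -> 0 <= r -> 0 <= s ->
  g (r + s) <= g (2 * r) + g (2 * s).
Proof.
move=> Kg r0 s0; have [rs|/ltW sr] := leP r s.
- apply: (@le_trans _ _ (g (2 * s))).
    by apply: class_K_le => //; lra.
  by rewrite lerDr class_K_ge0// mulr_ge0.
- apply: (@le_trans _ _ (g (2 * r))).
    by apply: class_K_le => //; lra.
  by rewrite lerDl class_K_ge0// mulr_ge0.
Qed.

Lemma class_K_small g (e : R) : class_K g -> 0 < e ->
  exists2 d : R, 0 < d & g d <= e.
Proof.
move=> Kg e0; have [cg _ g0] := Kg.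
have [_ cg0] := (continuous_within_itvcyP 0 g).1 cg.
have := (cvgrPdist_le _ _).1 cg0 _ e0; rewrite g0 => ge.
near (0 : R)^'+ => d; exists d; first by near: d; exact: nbhs_right_gt.
have : `|0 - g d| <= e by near: d; exact: ge.
rewrite sub0r normrN; apply: le_trans; exact: ler_norm.
Unshelve. all: by end_near. Qed.

Lemma class_L_ge0 l t : class_L l -> 0 <= t -> 0 <= l t.
Proof.
move=> [_ dec l0] t0; rewrite leNgt; apply/negP => lt0.
have := (cvgrPdist_lt _ _).1 l0 (- l t); rewrite oppr_gt0 => /(_ _ lt0) near_l.
near (pinfty_nbhs R) => s.
have ts : t < s by near: s; apply: nbhs_pinfty_gt; exact: num_real.
have : `|0 - l s| < - l t by near: s; exact: near_l.
rewrite sub0r normrN; have := ler_norm (- l s); rewrite normrN.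
by have := dec _ _ t0 ts; lra.
Unshelve. all: by end_near. Qed.

Lemma class_L_gt0 l t : class_L l -> 0 <= t -> 0 < l t.
Proof.
move=> Ll t0; have [_ dec _] := Ll.
have t1 : t < t + 1 by rewrite ltrDl.
by rewrite (le_lt_trans _ (dec _ _ t0 t1))// class_L_ge0// (le_trans t0)// ltW.
Qed.

Lemma class_L_small l (e : R) : class_L l -> 0 < e ->
  exists2 t : R, 0 <= t & l t <= e.
Proof.
move=> [_ _ l0] e0; have le := (cvgrPdist_le _ _).1 l0 _ e0.
near (pinfty_nbhs R) => t; exists t.
  by near: t; apply: nbhs_pinfty_ge; exact: num_real.
have : `|0 - l t| <= e by near: t; exact: le.
rewrite sub0r normrN; apply: le_trans; exact: ler_norm.
Unshelve. all: by end_near. Qed.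

Lemma class_LZ (k : R) l : 0 < k -> class_L l -> class_L (fun t => k * l t).
Proof.
move=> k0 [cl dl l0]; split.
- by move=> t; apply: cvgM; [exact: cvg_cst|exact: cl].
- by move=> s t s0 st; rewrite ltr_pM2l// dl.
- by rewrite -[X in _ --> X](mulr0 k); apply: cvgM => //; exact: cvg_cst.
Qed.

Lemma class_L_sqrt l : class_L l -> class_L (fun t => Num.sqrt (l t)).
Proof.
move=> Ll; have [cl dl l0] := Ll; split.
- by move=> t; apply: continuous_comp; [exact: cl|exact: sqrt_continuous].
- move=> s t s0 st; rewrite ltr_sqrt ?dl//; exact: class_L_gt0.
- rewrite -[X in _ --> X]sqrtr0; apply: continuous_cvg => //.
  exact: sqrt_continuous.
Qed.

Lemma class_KL_mul g l : class_K g -> class_L l ->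
  class_KL (fun r t => g r * l t).
Proof.
move=> Kg Ll; have [cg _ _] := Kg; have [cl _ _] := Ll; split.
- move=> p; apply: cvgM.
  + have := @within_continuous_comp_sub _ _ _
      [set p : R * R | 0 <= p.1 /\ 0 <= p.2] (`[0, +oo[ : set R) fst g.
    apply => //; last by apply: continuous_subspaceT => q; exact: cvg_fst.
    by move=> q [q1 _]; rewrite /= in_itv/= q1.
  + have := @within_continuous_comp_sub _ _ _
      [set p : R * R | 0 <= p.1 /\ 0 <= p.2] (`[0, +oo[ : set R) snd l.
    apply => //; last by apply: continuous_subspaceT => q; exact: cvg_snd.
    by move=> q [_ q2]; rewrite /= in_itv/= q2.
- move=> t t0; have -> : (fun r => g r * l t) = (fun r => l t * g r).
    by apply/funext => r; rewrite mulrC.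
  by apply: class_KZ => //; exact: class_L_gt0.
- by move=> r r0; apply: class_LZ => //; exact: class_K_gt0.
Qed.

(** The supremum of the z - (t - s)^+ over the family is 1-Lipschitz and
    nonincreasing in t, is at least z at t = s, and tends to zero: late members
    are small, and the early ones are eventually cut off by the penalty t - s.
    Adding 1 / (1 + t) makes it strictly decreasing. *)
Lemma class_L_majorant (S : set (R * R)) (M : R) :
  (forall s z, S (s, z) -> 0 <= s /\ z <= M) ->
  (forall e, 0 < e -> exists T, forall s z, S (s, z) -> T <= s -> z <= e) ->
  exists2 l, class_L l & forall s z, S (s, z) -> z <= l s.
Proof.
move=> SM S0.
(* the value 0 makes the supremum nonnegative, also when S is empty *)
pose D t := [set d : R | d = 0 \/
  exists s z, S (s, z) /\ d = z - Num.max 0 (t - s)].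
pose w t := sup (D t).
have M0 t : ubound (D t) (Num.max 0 M).
  move=> d [->|[s [z [Ssz ->]]]]; first by rewrite le_max lexx.
  rewrite le_max; apply/orP; right.
  have [_ zM] := SM _ _ Ssz.
  have : 0 <= Num.max 0 (t - s) by rewrite le_max lexx.
  lra.
have supD t : has_sup (D t) by split; [exists 0; left|exists (Num.max 0 M)].
have w_ge t d : D t d -> d <= w t by move=> Dd; exact: sup_upper_bound.
have w_le t c : 0 <= c ->
    (forall s z, S (s, z) -> z - Num.max 0 (t - s) <= c) -> w t <= c.
  move=> c0 Sc; apply: ge_sup; first by exists 0; left.
  by move=> d [->//|[s [z [Ssz ->]]]]; exact: Sc.
have w0 t : 0 <= w t by apply: w_ge; left.
have wS t s z : S (s, z) -> z - Num.max 0 (t - s) <= w t.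
  by move=> Ssz; apply: w_ge; right; exists s, z.
have w_lip t t' : w t <= w t' + `|t - t'|.
  apply: w_le => [|s z Ssz]; first by rewrite addr_ge0.
  have := wS t' _ _ Ssz; have := ler_norm (t' - t); rewrite distrC.
  by case: (leP 0 (t - s)) => ?; case: (leP 0 (t' - s)) => ?;
    have := normr_ge0 (t - t'); lra.
have w_dec t t' : t <= t' -> w t' <= w t.
  move=> tt'; apply: w_le => // s z /(wS t).
  by case: (leP 0 (t - s)) => ?; case: (leP 0 (t' - s)) => ?; lra.
have w_small e : 0 < e -> exists2 T, 0 <= T & forall t, T <= t -> w t <= e.
  move=> e0; have [T ST] := S0 _ e0.
  exists (Num.max 0 T + Num.max 0 M); first by rewrite addr_ge0// le_max lexx.
  move=> t tT; apply: w_le; first exact: ltW.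
  move=> s z Ssz; have [Ts|sT] := leP T s.
    have := ST _ _ Ssz Ts; have : 0 <= Num.max 0 (t - s) by rewrite le_max lexx.
    lra.
  have [_ zM] := SM _ _ Ssz.
  have : t - s <= Num.max 0 (t - s) by rewrite le_max lexx orbT.
  have : M <= Num.max 0 M by rewrite le_max lexx orbT.
  have : T <= Num.max 0 T by rewrite le_max lexx orbT.
  lra.
exists (fun t => w t + (1 + t)^-1); last first.
  move=> s z Ssz; have [s0 _] := SM _ _ Ssz.
  have := wS s _ _ Ssz; rewrite subrr maxxx.
  have : 0 <= (1 + s)^-1 by rewrite invr_ge0 addr_ge0.
  lra.
split.
- have cw : continuous w.
    move=> t; apply/cvgrPdist_le => e e0; near=> t'.
    have : `|t - t'| <= e by near: t'; exact: (cvgrPdist_le _ _).1 cvg_id _ e0.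
    have := w_lip t t'; have := w_lip t' t; rewrite [`|t' - t|]distrC.
    by move=> w1 w2 tt'; rewrite ler_norml; apply/andP; split; lra.
  apply: continuous_in_subspaceT => t; rewrite inE/= in_itv/= andbT => t0.
  apply: cvgD; first exact: cw.
  apply: cvgV; first by rewrite gt_eqF// ltr_pwDl.
  by apply: cvgD; [exact: cvg_cst|exact: cvg_id].
- move=> s t s0 st; rewrite ler_ltD ?w_dec ?ltW//.
  by rewrite ltf_pV2 ?posrE ?ltrD2l//; lra.
- apply/cvgrPdist_le => e e0.
  have e2 : 0 < e / 2 by rewrite divr_gt0.
  have [T T0 wT] := w_small _ e2.
  near=> t.
  have tT : T <= t by near: t; apply: nbhs_pinfty_ge; exact: num_real.
  have te : 2 / e <= t by near: t; apply: nbhs_pinfty_ge; exact: num_real.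
  have t0 : 0 <= t by exact: le_trans tT.
  have := wT _ tT; have := w0 t.
  have : 0 <= (1 + t)^-1 by rewrite invr_ge0 addr_ge0.
  have : (1 + t)^-1 <= e / 2.
    rewrite -[e / 2]invrK lef_pV2 ?posrE ?invr_gt0//; last by lra.
    by rewrite invf_div; lra.
  by move=> *; rewrite sub0r normrN ler_norml; apply/andP; split; lra.
Unshelve. all: by end_near. Qed.

(** With C(a) = (1 + a)(1 + sigma(a)), the quotient y / C(a) is at most
    1 / (1 + a), hence small for large a whatever s is; for bounded a it is
    small for large s.  So it is dominated by some l(s) with l of class L, and
    the square root of the product of the two bounds sigma(a) and C(a) l(s) has
    class KL. *)
Lemma class_KL_majorant (sigma : R -> R) (S : set (R * R * R)) :
  class_K sigma ->
  (forall a s y, S (a, s, y) -> [/\ 0 <= a, 0 <= s & y <= sigma a]) ->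
  (forall r e, 0 < e ->
    exists T, forall a s y, S (a, s, y) -> a <= r -> T <= s -> y <= e) ->
  exists2 b, class_KL b & forall a s y, S (a, s, y) -> y <= b a s.
Proof.
move=> Ks Sb S0.
pose C r := (1 + r) * (1 + sigma r).
have C_gt0 r : 0 <= r -> 0 < C r.
  move=> r0; have := class_K_ge0 Ks r0; rewrite /C => ?.
  by rewrite mulr_gt0//; lra.
have C_le r s : 0 <= r -> r <= s -> C r <= C s.
  move=> r0 rs; have := class_K_ge0 Ks r0; have := class_K_le Ks r0 rs.
  by move=> *; rewrite /C ler_pM//; lra.
have C_ge a : 0 <= a -> (1 + a) * sigma a <= C a.
  by move=> a0; rewrite /C ler_wpM2l//; lra.
pose S2 := [set p : R * R | exists a y, S (a, p.1, y) /\ p.2 = y / C a].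
have [|e e0|l Ll lS] := @class_L_majorant S2 1.
- move=> s z [a [y [/Sb[a0 s0 ys] /= ->]]]; split => //.
  rewrite ler_pdivrMr ?C_gt0// mul1r (le_trans ys)// (le_trans _ (C_ge _ a0))//.
  by rewrite ler_peMl ?class_K_ge0//; lra.
- (* beyond the radius e^-1 the factor 1 + a alone makes y / C a small *)
  have [T ST] := S0 e^-1 e e0; exists T => s z [a [y [Sy /= ->]]] Ts.
  have [a0 s0 ys] := Sb _ _ _ Sy; rewrite ler_pdivrMr ?C_gt0//.
  have [ae|ea] := leP a e^-1.
    rewrite (le_trans (ST _ _ _ Sy ae Ts))// ler_peMr ?(ltW e0)//.
    have := class_K_ge0 Ks a0.
    by move=> s1; rewrite /C; apply: mulr_ege1; lra.
  rewrite (le_trans ys)//.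
  apply: (@le_trans _ _ (e * ((1 + a) * sigma a))); last first.
    by rewrite ler_wpM2l ?C_ge// ltW.
  rewrite mulrA ler_peMl ?class_K_ge0//.
  by rewrite -ler_pdivrMl// mulr1; lra.
pose k r := Num.sqrt (sigma r * C r).
have [cs incs s0] := Ks.
have Kk : class_K k.
  split; last by rewrite /k s0 mul0r sqrtr0.
  - move=> r; apply: continuous_comp; last exact: sqrt_continuous.
    apply: cvgM; first exact: cs.
    apply: cvgM; first last.
      by apply: cvgD; [exact: cvg_cst|exact: cs].
    apply: (@continuous_subspaceT _ _ _ (fun r : R => 1 + r)) => x.
    by apply: cvgD; [exact: cvg_cst|exact: cvg_id].
  - move=> r t r0 rt; have t0 := le_lt_trans r0 rt.
    rewrite /k ltr_sqrt; last first.
      by rewrite mulr_gt0 ?(class_K_gt0 Ks t0) ?(C_gt0 _ (ltW t0)).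
    apply: (@le_lt_trans _ _ (sigma r * C t)).
      by rewrite ler_wpM2l ?class_K_ge0// C_le// ltW.
    by rewrite ltr_pM2r ?incs// C_gt0// ltW.
exists (fun r t => k r * Num.sqrt (l t)).
  by apply: class_KL_mul => //; exact: class_L_sqrt.
move=> a s y Sy; have [a0 t0 ys] := Sb _ _ _ Sy.
have yl : y <= C a * l s.
  rewrite -ler_pdivrMl ?C_gt0// mulrC; apply: lS.
  by exists a, y.
rewrite /k -sqrtrM; last first.
  by rewrite mulr_ge0 ?(class_K_ge0 Ks a0) ?(ltW (C_gt0 _ a0)).
have [y0|/ltW y0] := leP 0 y; last by rewrite (le_trans y0)// sqrtr_ge0.
rewrite -[leLHS]ger0_norm// -sqrtr_sqr ler_wsqrtr//.
by rewrite expr2 -mulrA ler_pM.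
Qed.

End ComparisonFunctionLemmas.

(** * Strong input-to-state stability *)

Section StrongISS.
Context {R : realType} {n m : nat}.
Variables (nX : 'rV[R]_n -> R) (nU : 'rV[R]_m -> R).
Variables (f : 'rV[R]_n -> 'rV[R]_m -> 'rV[R]_n).
Variables (phi : R -> 'rV[R]_n -> (R -> 'rV[R]_m) -> 'rV[R]_n).
Hypotheses (nX_norm : is_norm nX) (nU_norm : is_norm nU).
Hypotheses (f_lip : locally_lipschitz_unif nX f).
Hypotheses (f_complete : forward_complete nU f phi).

Lemma ISS_sISS : ISS nX nU phi -> sISS nX nU phi.
Proof.
move=> [b [g [[cb Kb Lb] Kg iss]]].
have b_ge0 r t : 0 <= r -> 0 <= t -> 0 <= b r t.
  by move=> r0 t0; exact: (class_K_ge0 (Kb _ t0)).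
have b_le r t : 0 <= r -> 0 <= t -> b r t <= b r 0.
  rewrite le_eqVlt => /predU1P[<-|r0] t0.
    by have [_ _ ->] := Kb _ t0; have [_ _ ->] := Kb _ (lexx 0).
  have [_ dec _] := Lb _ r0.
  by move: t0; rewrite le_eqVlt => /predU1P[<-//|t0]; rewrite ltW// dec.
have Kid : class_K (fun r : R => r).
  by split => //; apply: continuous_subspaceT => r; exact: cvg_id.
exists g, (fun r => b r 0 + r), (fun x => b (nX x)); split => //.
- split; first exact: class_KD (Kb _ (lexx 0)) Kid.
  move=> M; exists (Num.max 0 M + 1); first by rewrite addr_ge0// le_max lexx.
  have M0 : 0 <= Num.max 0 M by rewrite le_max lexx.
  have MM : M <= Num.max 0 M by rewrite le_max lexx orbT.
  have : 0 <= b (Num.max 0 M + 1) 0 by rewrite b_ge0// addr_ge0.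
  lra.
- by move=> x t t0; rewrite b_ge0// (is_norm_ge0 nX_norm).
- by move=> x x0; apply: Lb; exact: is_norm_gt0.
- split => // x t t0; rewrite (le_trans (b_le _ _ (is_norm_ge0 nX_norm x) t0))//.
  by rewrite lerDl (is_norm_ge0 nX_norm).
Qed.

Variables (b : 'rV[R]_n -> R -> R) (g sigma : R -> R).
Hypotheses (Kg : class_K g) (Ks : class_K sigma).
Hypotheses (b_L : forall x, x != 0 -> class_L (b x)).
Hypotheses (b_le : forall x t, 0 <= t -> b x t <= sigma (nX x)).
Hypotheses (phi_le : forall x u t, input nU u -> 0 <= t ->
  nX (phi t x u) <= b x t + g (input_norm nU u)).

Let nX_ge0 := is_norm_ge0 nX_norm.
Let g_ge0 u : 0 <= g (input_norm nU u).
Proof. by apply: class_K_ge0 => //; exact: input_norm_ge0. Qed.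

Lemma uniform_boundedness x u t : input nU u -> 0 <= t ->
  nX (phi t x u) <= sigma (nX x) + g (input_norm nU u).
Proof. by move=> iu t0; rewrite (le_trans (phi_le x iu t0))// lerD2r b_le. Qed.

Lemma settling_time x e : 0 < e -> exists2 t, 0 <= t & b x t <= e.
Proof.
move=> e0; have [->|/b_L /class_L_small] := eqVneq x 0; last exact.
exists 0 => //; rewrite (le_trans (b_le _ (lexx 0)))// (is_norm0 nX_norm).
by have [_ _ ->] := Ks; exact: ltW.
Qed.

(** The trajectory after time c is the trajectory from phi(c, x, u) driven by
    the shifted input, whose norm is not larger. *)
Lemma restart_bound x u c t : input nU u -> 0 <= c -> c <= t ->
  nX (phi t x u) <= sigma (nX (phi c x u)) + g (input_norm nU u).
Proof.
move=> iu c0 ct; have tc0 : 0 <= t - c by rewrite subr_ge0.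
rewrite -{1}(subrKC c t) (flow_cocycle nX_norm f_lip nU_norm f_complete)//.
rewrite (le_trans (uniform_boundedness _ (input_tail nU_norm c0 iu) tc0))//.
rewrite lerD2l; apply: class_K_le => //; first exact: input_norm_ge0.
exact: input_norm_tail.
Qed.

(** The settling time T0 of a state x serves for all states y near x, because at
    time T0 the trajectories from x and y driven by a common u are close,
    uniformly in u, and from then on the one from y stays small by
    restart_bound.  Compactness of the ball makes T0 uniform. *)
Lemma uniform_attractivity r e : 0 < e -> exists T, forall x u t,
  nX x <= r -> input nU u -> input_norm nU u <= r -> 0 <= t -> T <= t ->
  nX (phi t x u) <=
    e + (sigma (2 * g (input_norm nU u)) + g (input_norm nU u)).
Proof.
move=> e0.
pose P (T : R) x := forall u t, input nU u -> input_norm nU u <= r -> 0 <= t ->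
  T <= t -> nX (phi t x u) <=
    e + (sigma (2 * g (input_norm nU u)) + g (input_norm nU u)).
suff near_P : \forall T \near +oo, [set x | nX x <= r] `<=` P T.
  near (pinfty_nbhs R) => T; exists T => x u t xr iu ur t0 Tt.
  have PT : [set x | nX x <= r] `<=` P T by near: T; exact: near_P.
  exact: PT.
have [d d0 sd] := class_K_small Ks e0.
have d4 : 0 < d / 4 by rewrite divr_gt0.
have [A A0 NA] := is_norm_le_sup nX_norm.
have /compact_near_coveringP cov := compact_is_norm_ball (r := r) nX_norm.
apply: cov => x /= xr; have [T0 T0_ge0 bT0] := settling_time x d4.
pose K := sigma (r + 1) + g r.
have [C C0 dist] := caratheodory_solution_dist_ball nX_norm f_lip K T0.
have bounded y u s : nX y <= r + 1 -> input nU u -> input_norm nU u <= r ->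
    0 <= s <= T0 -> nX (phi s y u) <= K.
  move=> yr iu ur /andP[s0 _]; rewrite (le_trans (uniform_boundedness _ iu s0))//.
  by rewrite lerD// class_K_le// input_norm_ge0.
(* nX (y - x) is at most 1, so y is in the larger ball, and at most d / (4 C) *)
pose eta := Num.min (1 / A) (d / 4 / C / A).
have eta0 : 0 < eta by rewrite lt_min !divr_gt0.
exists (ball x eta, [set T | T0 < T]).
  by split => /=; [exact: nbhsx_ballx|apply: nbhs_pinfty_gt; exact: num_real].
move=> [y T] [/= xy T0T] u t iu ur t0 Tt.
have {xy} : `|y - x| < eta by move: xy; rewrite -ball_normE/= distrC.
rewrite lt_min !ltr_pdivlMr// => /andP[yx1 yx2].
have yx : nX (y - x) <= A * `|y - x| := NA _.
have yr : nX y <= r + 1.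
  by have := is_norm_lipschitz nX_norm y x; lra.
have xr1 : nX x <= r + 1 by lra.
have close : nX (phi T0 y u - phi T0 x u) <= d / 4.
  have := dist _ _ _ _ _ (f_complete y iu) (f_complete x iu).
  move=> /(_ (fun s => bounded y u s yr iu ur) (fun s => bounded x u s xr1 iu ur)).
  move=> /(_ T0); rewrite T0_ge0 lexx => /(_ isT) /le_trans; apply.
  rewrite (@le_trans _ _ (C * (A * `|y - x|)))//; first by rewrite ler_wpM2l// ltW.
  lra.
set v := input_norm nU u in ur *; have gv : 0 <= g v := g_ge0 u.
have T0t : T0 <= t by rewrite (le_trans (ltW T0T)).
rewrite (le_trans (restart_bound y iu T0_ge0 T0t))// addrA lerD2r.
have yT0 : nX (phi T0 y u) <= d / 2 + g v.
  have := is_norm_lipschitz nX_norm (phi T0 y u) (phi T0 x u).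
  have := phi_le x iu T0_ge0; rewrite -/v; lra.
rewrite (le_trans (class_K_le Ks (nX_ge0 _) yT0))//.
(* the state at time T0 is at most d / 2 + g v, and sigma d <= e *)
rewrite (le_trans (class_KD_le Ks _ gv)) ?divr_ge0 ?(ltW d0)//.
rewrite lerD2r (le_trans _ sd)//.
by rewrite mulrC divfK.
Unshelve. all: by end_near. Qed.

Lemma strong_ISS_ISS : ISS nX nU phi.
Proof.
(* the last term is for inputs of larger norm than the initial state *)
pose gain v := sigma (2 * g v) + g v + sigma v.
have Kgain : class_K gain.
  apply: class_KD => //; apply: class_KD => //.
  by apply: class_K_comp => //; exact: class_KZ.
pose S := [set p : R * R * R | exists x u t, [/\ input nU u, 0 <= t &
  p = (nX x, t, nX (phi t x u) - gain (input_norm nU u))]].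
have [| |beta KLbeta Sbeta] := @class_KL_majorant _ sigma S Ks.
- move=> a s y [x [u [t [iu t0 [-> -> ->]]]]]; split => //.
  have v0 := input_norm_ge0 nU_norm u.
  have := uniform_boundedness x iu t0; have := class_K_ge0 Ks v0.
  have : 0 <= sigma (2 * g (input_norm nU u)).
    by apply: class_K_ge0 => //; rewrite mulr_ge0.
  rewrite /gain; lra.
- move=> r e e0; have [T attr] := uniform_attractivity r e0; exists T.
  move=> a s y [x [u [t [iu t0 [-> -> ->]]]]] xr Tt.
  have v0 := input_norm_ge0 nU_norm u.
  have sv := class_K_ge0 Ks v0.
  have sg : 0 <= sigma (2 * g (input_norm nU u)).
    by apply: class_K_ge0 => //; rewrite mulr_ge0.
  rewrite /gain; have [vr|rv] := leP (input_norm nU u) r.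
    by have := attr _ _ _ xr iu vr t0 Tt; lra.
  have := uniform_boundedness x iu t0.
  have : sigma (nX x) <= sigma (input_norm nU u).
    by apply: class_K_le => //; rewrite (le_trans xr)// ltW.
  lra.
exists beta, gain; split => // x u t iu t0.
rewrite -lerBlDr; apply: Sbeta; by exists x, u, t.
Qed.

End StrongISS.

Theorem proposition11 (R : realType) (n m : nat)
    (nX : 'rV[R]_n -> R) (nU : 'rV[R]_m -> R)
    (f : 'rV[R]_n -> 'rV[R]_m -> 'rV[R]_n)
    (phi : R -> 'rV[R]_n -> (R -> 'rV[R]_m) -> 'rV[R]_n)
    (nX_norm : is_norm nX) (nU_norm : is_norm nU)
    (f_continuous : continuous (fun p : 'rV[R]_n * 'rV[R]_m => f p.1 p.2))
    (f_lipschitz : locally_lipschitz_unif nX f)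
    (f_complete : forward_complete nU f phi) :
  sISS nX nU phi <-> ISS nX nU phi.
Proof.
split; last exact: ISS_sISS.
move=> [g [sigma [b [Kg [Ks _] b_ge0 b_L [b_le phi_le]]]]].
exact: (strong_ISS_ISS nX_norm nU_norm f_lipschitz f_complete Kg Ks b_L b_le).
Qed.
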